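(* Let $d \in \mathbb{N}$, let $M \ge 8$, and let $\{t_j\}_{j\in\mathbb{N}}$ be a sequence of positive real numbers with $t_1 \ge 2$ and $$\frac{t_{j+1}}{t_j} \ge 1+\frac{1}{M} \quad \text{for all } j \in \mathbb{N}.$$ Let $\{S_j\}_{j\in\mathbb{N}}$ be a sequence of real orthogonal $d\times d$ matrices and put $G_j = t_j S_j$. Then there exists a real vector $\alpha = (\alpha_1,\dots,\alpha_d)\in\mathbb{R}^d$ such that $$\|G_j\alpha\| \ge \frac{1}{2^{13}\, d\,(M\log M)^{1/d}} \quad \text{for all } j\in\mathbb{N}.$$
   Context: For a vector $\xi=(\xi_1,\dots,\xi_d)\in\mathbb{R}^d$, $\|\xi\| = \max_{1\le k\le d}\min_{a\in\mathbb{Z}}|\xi_k - a|$, i.e. the sup-norm distance from $\xi$ to the integer lattice $\mathbb{Z}^d$. *)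

(* Defs.v *)
From HB Require Import structures.
From mathcomp Require Import all_boot all_order all_algebra.
From mathcomp Require Import all_classical all_reals all_analysis.
From mathcomp Require Import lra.
Set Implicit Arguments.
Unset Strict Implicit.
Unset Printing Implicit Defensive.
Import Order.TTheory GRing.Theory Num.Theory.
Local Open Scope classical_set_scope.
Local Open Scope ring_scope.

(* min over a in Z of |x - a|; the infimum is attained by dist_int_min. *)
Definition dist_int (R : realType) (x : R) : R :=
  inf [set `|x - a%:~R| | a in [set: int]].

Lemma dist_int_min (R : realType) (x : R) :
  exists a : int, dist_int x = `|x - a%:~R| /\
    forall b : int, `|x - a%:~R| <= `|x - b%:~R|.
Proof.
suff [a ha] : exists a : int, forall b : int, `|x - a%:~R| <= `|x - b%:~R|.
  exists a; split=> //; apply/eqP; rewrite eq_le; apply/andP; split.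
    apply: ge_inf; last by exists a.
    by exists 0 => _ [b _ <-].
  apply: lb_le_inf; first by exists `|x - a%:~R|; exists a.
  by move=> _ [b _ <-]; exact: ha.
have h1 := floor_le x; have h2 := floorD1_gt x.
set n := Num.floor x in h1 h2.
have E (b : int) : b%:~R <= n%:~R :> R \/ (n + 1)%:~R <= b%:~R :> R.
  by case: (leP b n) => hb; [left|right]; rewrite ler_int // lezD1.
rewrite intrD in h2; rewrite intrD in E.
case: (leP (x - n%:~R) (n%:~R + 1 - x)) => hx.
  exists n => b; rewrite (ger0_norm (x := x - n%:~R)) ?subr_ge0 // ler_normr.
  by apply/orP; case: (E b) => hb; [left|right]; lra.
exists (n + 1) => b; rewrite intrD distrC.
rewrite (ger0_norm (x := n%:~R + 1 - x)) ?subr_ge0 ?(ltW h2) // ler_normr.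
by apply/orP; case: (E b) => hb; [left|right]; lra.
Qed.

(* The value 0 of the empty maximum is irrelevant for d > 0, since dist_int
   is nonnegative. *)
Definition dist_lattice (R : realType) (d : nat) (xi : 'cV[R]_d) : R :=
  \big[Num.max/0]_(k < d) dist_int (xi k 0).

Definition orthogonal_mx (R : realType) (d : nat) (S : 'M[R]_d) : Prop :=
  S^T *m S = 1%:M.

(* Main.v *)
Require Import Defs.
From HB Require Import structures.
From mathcomp Require Import all_boot all_order all_algebra.
From mathcomp Require Import all_classical all_reals all_analysis.
From mathcomp Require Import lra ring zify.
Import Order.TTheory GRing.Theory Num.Theory numFieldNormedType.Exports.
Local Open Scope ring_scope.

(* The Peres-Schlag argument, with Lebesgue measure replaced by counting dyadic
   cubes. With delta the required bound, cut [0, 1)^d into dyadic cubes of side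
   about sqrt d * delta / t_j. Inside a larger cube of side s >= 1 / (t_j sqrt d),
   the coordinates of G_j alpha vary by at most t_j * sqrt d * s, so at most
   (5 t_j sqrt d s)^d integer points n are relevant, and each n spoils boundedly
   many small cubes per coordinate: the spoiled proportion is at most
   p = (20 d delta)^d. By lacunarity the cubes attached to the index j - h, with
   h = O(M log M), are already that large compared with 1 / t_j, so the number of
   cubes lost at step j is at most p times the number alive at step j - h. As
   p h <= 1/4 this delayed recursion never dies, and compactness handles all j
   at once. *)

(** * Positivity for a recursion with delay *)

(** The induction also carries the decay bound s(i+1) >= (1 - 2p) s(i). Over at most h steps this
    loses at most half, because p h <= 1/4, so the delayed term is at most 2 s(j), which reproduces
    the decay bound at the next index. *)
Lemma delayed_recursion_gt0 (R : realFieldType) (s : nat -> R) (p : R)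
    (h N : nat) :
  0 <= p -> p * h%:R <= 1 / 4 -> 0 < s 0%N ->
  (forall j, (j < N)%N -> s j - p * s (j.+1 - h)%N <= s j.+1) ->
  forall j, (j <= N)%N -> 0 < s j.
Proof.
move=> p0 ph s0 rec.
(* For [h = 0] the delayed term is [s j.+1] itself, and the recursion reads s(j) <= (1 + p)
   s(j+1). *)
have [h0|h0] := posnP h.
  move: rec; rewrite h0 => rec; elim=> // j IH jN.
  have := rec j jN; rewrite subn0; have := IH (ltnW jN) => ? ?.
  by have : s j.+1 * (1 + p) > 0; [nra|rewrite pmulr_lgt0 //; lra].
have p4 : p <= 1 / 4.
  by apply: le_trans ph; rewrite ler_peMr // ler1n.
have key j : (j <= N)%N -> (forall i, (i <= j)%N -> 0 < s i) /\
    forall i, (i < j)%N -> (1 - 2 * p) * s i <= s i.+1.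
  elim: j => [|j IH] jN; first by split=> // i; rewrite leqn0 => /eqP->.
  have [pos dec] := IH (ltnW jN).
  have sj := pos _ (leqnn j).
  (* Bernoulli's inequality for the accumulated factor (1 - 2p)^k. *)
  have far k i : (i + k <= j)%N -> 0 < s i ->
      (1 - 2 * p * k%:R) * s i <= s (i + k)%N.
    elim: k => [|k IHk] ikj si; first by rewrite addn0; lra.
    rewrite addnS in ikj *.
    have := dec _ ikj; have := IHk (ltnW ikj) si; rewrite -natr1.
    have : 0 <= k%:R :> R by rewrite ler0n.
    set a := k%:R; move=> a0 e1 e2; apply: le_trans e2.
    have : (1 - 2 * p) * ((1 - 2 * p * a) * s i) <= (1 - 2 * p) * s (i + k)%N.
      by rewrite ler_wpM2l //; lra.
    apply: le_trans; rewrite mulrA ler_wpM2r ?(ltW si) //; nra.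
  have sjh : s (j.+1 - h)%N <= 2 * s j.
    have sh : 0 < s (j.+1 - h)%N by apply: pos; lia.
    have hk : (j.+1 - h + (j - (j.+1 - h)))%N = j by lia.
    have := far (j - (j.+1 - h))%N (j.+1 - h)%N; rewrite hk => /(_ (leqnn _) sh).
    have kh : (j - (j.+1 - h))%:R <= h%:R :> R by rewrite ler_nat; lia.
    have : p * (j - (j.+1 - h))%:R <= 1 / 4.
      by apply: le_trans ph; rewrite ler_wpM2l.
    set a := (_ - _)%:R; nra.
  have st : (1 - 2 * p) * s j <= s j.+1.
    by apply: le_trans (rec _ jN); nra.
  split.
    move=> i; rewrite leq_eqVlt => /orP[/eqP->|]; last exact: pos.
    by nra.
  by move=> i; rewrite ltnS leq_eqVlt => /orP[/eqP->//|]; exact: dec.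
by move=> j /key[+ _]; apply.
Qed.

(** * Dyadic scales and counting by codes *)

Lemma dyadic_scale (R : realType) (x : R) : 0 < x -> x <= 1 ->
  exists l : nat, 1 <= 2 ^+ l * x < 2.
Proof.
move=> x0 x1.
have ex : exists l : nat, 1 <= 2 ^+ l * x.
  have := archi_boundP (ltW (_ : 0 < x^-1)); rewrite invr_gt0 => /(_ x0) lt.
  exists (Num.bound x^-1); rewrite -ler_pdivrMr // mul1r.
  apply/ltW/(lt_le_trans lt).
  by rewrite -natrX ler_nat ltnW // ltn_expl.
case: (ex_minnP ex) => l l1 lmin; exists l; rewrite l1 /=.
case: l l1 lmin => [|l] l1 lmin; first by rewrite expr0 mul1r; lra.
rewrite ltNge; apply/negP => h2.
have /lmin : 1 <= 2 ^+ l * x by move: h2; rewrite exprS; nra.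
by rewrite ltnn.
Qed.

(** The offset of floor y from a reference that does not depend on y is a natural number taking at
    most 2r + 2 values; it serves as a code for floor y. *)
Lemma floor_window (R : realType) (c r y : R) : `|y - c| <= r ->
  (Num.floor (c - r) <= Num.floor y) &&
  (`|Num.floor y - Num.floor (c - r)|%N.+1%:R <= 2 * r + 2).
Proof.
rewrite ler_distl => /andP[y1 y2].
have le : Num.floor (c - r) <= Num.floor y by apply: le_floor.
rewrite le /= -natr1 pmulrn gez0_abs ?subr_ge0 // intrB.
have := floor_le y; have := floorD1_gt (c - r); rewrite intrD /=; lra.
Qed.

Lemma leq_card_code (T : finType) (A : {set T}) (d a b c : nat)
    (f g h : T -> 'I_d -> nat) :
  (forall x k, x \in A -> [&& f x k < a, g x k < b & h x k < c]%N) ->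
  {in A &, forall x y,
    (forall k, [/\ f x k = f y k, g x k = g y k & h x k = h y k]) -> x = y} ->
  (#|A| <= (a * b * c) ^ d)%N.
Proof.
move=> bnd inj.
have [->|[x0 x0A]] := set_0Vmem A; first by rewrite cards0.
(* In dimension 0 no index is available to show a, b, c positive, as [inord] requires. *)
case: d f g h bnd inj => [|d] f g h bnd inj.
  rewrite expn0 -(cards1 x0); apply/subset_leq_card/fintype.subsetP => x xA.
  by rewrite inE; apply/eqP/inj => // -[].
have /and3P[] := bnd _ ord0 x0A.
case: a bnd => // a; case: b => // b; case: c => // c bnd _ _ _.
pose code x : {ffun 'I_d.+1 -> 'I_a.+1 * 'I_b.+1 * 'I_c.+1} :=
  [ffun k => (inord (f x k), inord (g x k), inord (h x k))].
have ci : {in A &, injective code}.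
  move=> x y xA yA /ffunP e; apply: inj => // k.
  have /and3P[fx gx hx] := bnd _ k xA; have /and3P[fy gy hy] := bnd _ k yA.
  have := e k; rewrite !ffunE => -[/(congr1 val) + /(congr1 val) + /(congr1 val)].
  by rewrite /= !inordK.
rewrite -(card_in_imset ci); apply: leq_trans (max_card _) _.
by rewrite card_ffun !card_prod !card_ord.
Qed.

(** * Orthogonal matrices and dyadic cubes *)

Lemma orthogonal_mx_tr (R : realType) (d : nat) (S : 'M[R]_d) :
  orthogonal_mx S -> orthogonal_mx S^T.
Proof. by rewrite /orthogonal_mx trmxK; exact: mulmx1C. Qed.

Lemma orthogonal_mx_bound (R : realType) (d : nat) (S : 'M[R]_d) (v : 'cV[R]_d)
    (e : R) (k : 'I_d) :
  (0 < d)%N -> orthogonal_mx S -> (forall i, `|v i 0| <= e) ->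
  `|(S *m v) k 0| <= Num.sqrt d%:R * e.
Proof.
move=> d0 oS ve; set D := Num.sqrt _.
have D0 : 0 < D by rewrite sqrtr_gt0 ltr0n.
have DD : D * D = d%:R by rewrite -expr2 sqr_sqrtr // ler0n.
have e0 : 0 <= e by exact: le_trans (ve k).
have row : \sum_j S k j ^+ 2 = 1.
  have := orthogonal_mx_tr _ _ _ oS; rewrite /orthogonal_mx trmxK.
  move=> /matrixP/(_ k k); rewrite !mxE eqxx mulr1n => <-.
  by apply: eq_bigr => j _; rewrite mxE expr2.
(* AM-GM on each entry gives the l^1 norm of a unit row at most sqrt d. *)
have l1 : \sum_j `|S k j| <= D.
  have -> : D = \sum_j (D * S k j ^+ 2 / 2 + (D^-1) / 2).
    rewrite big_split /= -mulr_suml -mulr_sumr row sumr_const card_ord mulr1.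
    have -> : D^-1 / 2 *+ d = D / 2; last lra.
    by rewrite -mulr_natl mulrA -DD mulfK // gt_eqF.
  apply: ler_sum => j _; rewrite -real_normK ?num_real //.
  set s := `|_|.
  have := sqr_ge0 (D * s - 1) => sq.
  rewrite -(ler_pM2l D0) mulrDr !mulrA mulfV ?gt_eqF //; nra.
rewrite mxE; apply: le_trans (ler_norm_sum _ _ _) _.
apply: le_trans (_ : \sum_j `|S k j| * e <= _); last first.
  by rewrite -mulr_suml ler_wpM2r.
by apply: ler_sum => j _; rewrite normrM ler_wpM2l.
Qed.

(* [x] is a cell of the finest grid, of mesh 2^-L, given by its integer
   coordinates; the predicate says that [alpha] lies in the dyadic cube of side
   2^-l containing that cell. *)
Definition in_dyadic_cube (R : realType) (d L l : nat)
    (x : {ffun 'I_d -> 'I_(2 ^ L)}) (alpha : 'cV[R]_d) : Prop :=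
  forall k, Num.floor (2 ^+ l * alpha k 0)%R = (x k %/ 2 ^ (L - l))%N :> int.

(** The inequality is strict so that the condition is open in v, and the lattice point is explicit
    so that it can be pulled back by the inverse matrix. *)
Definition near_lattice (R : realType) (d : nat) (delta : R) (v : 'cV[R]_d) :
    Prop :=
  exists n : 'I_d -> int, forall k, `|v k 0 - (n k)%:~R| < delta.

(** A cube of level l is spoiled as soon as one of its points is. It is recorded through its finest
    cells, so that sets from different levels are counted in one finite type. *)
Definition bad_cubes (R : realType) (d L l : nat) (delta : R) (G : 'M[R]_d) :
    {set {ffun 'I_d -> 'I_(2 ^ L)}} :=
  [set x | `[< exists2 alpha, in_dyadic_cube R d L l x alpha &
               near_lattice R d delta (G *m alpha) >]].

Definition same_cube (d L m : nat) (x y : {ffun 'I_d -> 'I_(2 ^ L)}) : bool :=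
  [forall k, x k %/ 2 ^ (L - m) == y k %/ 2 ^ (L - m)]%N.

Lemma same_cubeP (d L m : nat) (x y : {ffun 'I_d -> 'I_(2 ^ L)}) :
  reflect (forall k, x k %/ 2 ^ (L - m) = y k %/ 2 ^ (L - m))%N
          (same_cube d L m x y).
Proof. exact: 'forall_eqP. Qed.

Lemma divn_exp_sub (L l m n : nat) : (m <= l <= L)%N ->
  (n %/ 2 ^ (L - m) = n %/ 2 ^ (L - l) %/ 2 ^ (l - m))%N.
Proof. by move=> ?; rewrite -divnMA -expnD; congr (_ %/ 2 ^ _)%N; lia. Qed.

(** Dyadic cubes are nested, so alpha lies in the level m cube of y, whose lower corner is the point
    subtracted. *)
Lemma in_dyadic_cube_corner (R : realType) (d L l m : nat)
    (x y : {ffun 'I_d -> 'I_(2 ^ L)}) (alpha : 'cV[R]_d) (k : 'I_d) :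
  (m <= l <= L)%N -> in_dyadic_cube R d L l x alpha -> same_cube d L m x y ->
  `|alpha k 0 - (y k %/ 2 ^ (L - m))%:R / 2 ^+ m| <= 2 ^- m.
Proof.
move=> mlL cx /same_cubeP/(_ k); rewrite (divn_exp_sub L l m) // => <-.
have := floor_le (2 ^+ l * alpha k 0); have := floorD1_gt (2 ^+ l * alpha k 0).
rewrite intrD (cx k) -pmulrn; set q := (x k %/ 2 ^ (L - l))%N.
have e : 2 ^+ l = 2 ^+ m * 2 ^+ (l - m) :> R by rewrite -exprD subnKC //; lia.
have p0 : 0 < 2 ^+ m :> R by rewrite exprn_gt0.
have q0 : 0 < 2 ^+ (l - m) :> R by rewrite exprn_gt0.
have b1 : (q %/ 2 ^ (l - m))%:R * 2 ^+ (l - m) <= q%:R :> R.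
  by rewrite -natrX -natrM ler_nat leq_divM.
have b2 : q%:R + 1 <= ((q %/ 2 ^ (l - m))%:R + 1) * 2 ^+ (l - m) :> R.
  by rewrite !natr1 -natrX -natrM ler_nat ltn_ceil // expn_gt0.
rewrite e -mulrA; set a := 2 ^+ (l - m) in q0 b1 b2 *; set b := 2 ^+ m in p0 *.
set y' := (_ %/ _)%:R in b1 b2 *; set w := alpha k 0 => h1 h2.
rewrite -(ler_pM2l p0) mulfV ?gt_eqF // -[X in X * `|_|](gtr0_norm p0) -normrM.
rewrite mulrBr mulrCA mulfV ?gt_eqF // mulr1 ler_norml.
have h3 : a * y' <= a * (b * w) by lra.
have h4 : a * (b * w) <= a * (y' + 1) by lra.
by move: h3 h4; rewrite !ler_pM2l // => ? ?; apply/andP; split; lra.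
Qed.

(** * Counting the spoiled cells *)

(** Per coordinate there are at most 5T choices for n, then 4r for the level l index once n is
    known, then 2^(L-l) positions. The last two hypotheses, T >= 1 and r >= 1, absorb the
    rounding. *)
Lemma ler_card_bad_cubes (R : realType) (d L l m : nat) (delta t : R)
    (S : 'M[R]_d) (y : {ffun 'I_d -> 'I_(2 ^ L)}) :
  (0 < d)%N -> (m <= l <= L)%N -> 0 < delta <= 1 / 2 -> 0 < t ->
  orthogonal_mx S ->
  1 <= t * Num.sqrt d%:R / 2 ^+ m ->
  1 <= 2 ^+ l * (Num.sqrt d%:R * delta / t) ->
  #|[set x in bad_cubes R d L l delta (t *: S) | same_cube d L m x y]|%:R
    <= (20 * d%:R * delta) ^+ d * (2 ^+ (L - m)) ^+ d :> R.
Proof.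
move=> d0 mlL /andP[dl0 dl2] t0 oS; set D := Num.sqrt _ => T1 r1.
have D0 : 0 < D by rewrite sqrtr_gt0 ltr0n.
have DD : D * D = d%:R by rewrite -expr2 sqr_sqrtr // ler0n.
set T := t * D / 2 ^+ m in T1; set r := 2 ^+ l * _ in r1.
set A := [set x in _ | _].
pose good x (w : 'cV[R]_d * ('I_d -> int)) := in_dyadic_cube R d L l x w.1 /\
  forall k, `|(t *: S *m w.1) k 0 - (w.2 k)%:~R| < delta.
have /choice[w hw] x : exists w, x \in A -> good x w.
  have [|nA] := boolP (x \in A); last by exists (0, fun=> 0).
  by rewrite !inE => /andP[/asboolP[al c [n hn]] _]; exists (al, n).
pose alpha0 : 'cV[R]_d := \col_k ((y k %/ 2 ^ (L - m))%:R / 2 ^+ m).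
pose c1 k := (t *: S *m alpha0) k 0.
pose c2 (n : 'I_d -> int) k := 2 ^+ l * (t^-1 *: (S^T *m \col_j (n j)%:~R)) k 0.
have scE a (U : 'M[R]_d) (v : 'cV[R]_d) k :
    (a *: (U *m v)) k 0 = a * (U *m v) k 0.
  by rewrite mxE.
have subE (U : 'M[R]_d) (v v' : 'cV[R]_d) k :
    (U *m v) k 0 - (U *m v') k 0 = (U *m (v - v')) k 0.
  by rewrite mulmxBr [RHS]mxE; congr (_ + _); rewrite [RHS]mxE.
have win1 x k : x \in A -> `|((w x).2 k)%:~R - c1 k| <= T + delta.
  move=> xA; have [cx nx] := hw x xA.
  rewrite -(subrKA ((t *: S *m (w x).1) k 0)).
  rewrite addrC; apply: le_trans (ler_normD _ _) _; apply: lerD; last first.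
    by rewrite distrC ltW.
  rewrite /c1 -!scalemxAl !scE -mulrBr subE normrM gtr0_norm // /T -!mulrA.
  rewrite ler_pM2l //.
  apply: orthogonal_mx_bound => // i; rewrite !mxE.
  apply: in_dyadic_cube_corner mlL cx _.
  by move: xA; rewrite inE => /andP[].
have win2 x k : x \in A -> `|2 ^+ l * (w x).1 k 0 - c2 (w x).2 k| <= r.
  move=> xA; have [cx nx] := hw x xA; rewrite /c2 -mulrBr normrM /r.
  rewrite ger0_norm ?exprn_ge0 // ler_pM2l ?exprn_gt0 //.
  have -> : (w x).1 = t^-1 *: (S^T *m (t *: S *m (w x).1)).
    rewrite -scalemxAl -scalemxAr scalerA mulVf ?gt_eqF // scale1r mulmxA oS.
    by rewrite mul1mx.
  rewrite !scE -mulrBr subE normrM gtr0_norm ?invr_gt0 // mulrC.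
  rewrite ler_pM2r ?invr_gt0 //.
  apply: orthogonal_mx_bound (orthogonal_mx_tr _ _ _ oS) _ => // i.
  by rewrite !mxE; have := nx i; rewrite mxE => /ltW.
pose u1 x k := `|(w x).2 k - Num.floor (c1 k - (T + delta))|%N.
pose u2 x k := `|Num.floor (2 ^+ l * (w x).1 k 0)%R
                 - Num.floor (c2 (w x).2 k - r)|%N.
pose u3 (x : {ffun 'I_d -> 'I_(2 ^ L)}) k := (x k %% 2 ^ (L - l))%N.
(* In each coordinate a bad cell is determined by n, by the index of its cube of
   side 2^-l, which is near the preimage of n, and by its position therein. *)
have cnt : (#|A| <=
    (Num.truncn (5 * T) * Num.truncn (4 * r) * 2 ^ (L - l)) ^ d)%N.
  apply: (leq_card_code _ _ _ _ _ _ u1 u2 u3) => [x k xA|x x' xA x'A e].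
    have /andP[_ f1] := floor_window _ _ _ _ (win1 x k xA).
    have /andP[_ f2] := floor_window _ _ _ _ (win2 x k xA).
    rewrite ltn_mod expn_gt0 andbT !truncn_gt_nat.
    rewrite intrKfloor in f1.
    (* Here 2(T + delta) + 2 <= 5T, as delta <= 1/2, and 2r + 2 <= 4r. *)
    by apply/andP; split; [apply: le_trans f1 _|apply: le_trans f2 _]; lra.
  (* The lattice point is decoded first, because the reference floor in [u2] depends on it. *)
  have en : (w x).2 = (w x').2.
    apply/funext => k; have [+ _ _] := e k.
    have /andP[f1 _] := floor_window _ _ _ _ (win1 x k xA).
    have /andP[f2 _] := floor_window _ _ _ _ (win1 x' k x'A).
    rewrite !intrKfloor in f1 f2; move: f1 f2; rewrite /u1.
    by move: (Num.floor _) ((w x).2 k) ((w x').2 k) => a b c; lia.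
  apply/ffunP => k; apply: val_inj; have [_ e2 e3] := e k.
  have /andP[f1 _] := floor_window _ _ _ _ (win2 x k xA).
  have /andP[f2 _] := floor_window _ _ _ _ (win2 x' k x'A).
  have qq : (x k %/ 2 ^ (L - l) = x' k %/ 2 ^ (L - l))%N.
    have [cx _] := hw x xA; have [cx' _] := hw x' x'A.
    move: f1 f2 e2; rewrite /u2 -en cx cx'.
    by move: (Num.floor _) (x k %/ _)%N (x' k %/ _)%N => a b c; lia.
  rewrite /= (divn_eq (x k) (2 ^ (L - l))) qq.
  by rewrite [(x k %% _)%N]e3 -divn_eq.
have e : 2 ^+ (L - m) = 2 ^+ (L - l) * 2 ^+ l / 2 ^+ m :> R.
  apply: (mulIf (expf_neq0 m (_ : 2 != 0 :> R))); first by lra.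
  by rewrite divfK ?expf_neq0 ?pnatr_eq0 // -!exprD; congr (_ ^+ _); lia.
(* In the product T r the factor t cancels and the two factors sqrt d give d. *)
have -> : (20 * d%:R * delta) ^+ d * (2 ^+ (L - m)) ^+ d =
    (5 * T * (4 * r) * 2 ^+ (L - l)) ^+ d.
  rewrite -exprMn e /T /r -DD; congr (_ ^+ _); field.
  by rewrite expf_neq0 ?pnatr_eq0 // gt_eqF.
apply: le_trans (_ : ((Num.truncn (5 * T) * Num.truncn (4 * r) *
    2 ^ (L - l)) ^ d)%:R <= _); first by rewrite ler_nat.
have T0 : 0 <= 5 * T by lra.
have r0 : 0 <= 4 * r by lra.
move: (5 * T) (4 * r) T0 r0 => a b a0 b0.
rewrite natrX !natrM natrX lerXn2r ?nnegrE ?mulr_ge0 ?exprn_ge0 //.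
by rewrite ler_wpM2r ?exprn_ge0 // ler_pM // truncn_le.
Qed.

Lemma card_same_cube (d L m : nat) (y : {ffun 'I_d -> 'I_(2 ^ L)}) :
  (m <= L)%N ->
  ((2 ^ (L - m)) ^ d <= #|[set x | same_cube d L m x y]|)%N.
Proof.
move=> mL; set c := (2 ^ (L - m))%N.
have c0 : (0 < c)%N by rewrite expn_gt0.
pose f (z : {ffun 'I_d -> 'I_c}) : {ffun 'I_d -> 'I_(2 ^ L)} :=
  [ffun k => insubd (y k) (y k %/ c * c + z k)%N].
have fE z k : f z k = (y k %/ c * c + z k)%N :> nat.
  (* The default value of [insubd] never occurs: corner plus offset stays below 2^L. *)
  rewrite ffunE val_insubd ifT //.
  have yc : (y k %/ c < 2 ^ m)%N by rewrite ltn_divLR // -expnD subnKC.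
  have := leq_mul2r c (y k %/ c).+1 (2 ^ m); rewrite yc orbT -expnD subnKC //.
  by apply: leq_trans; rewrite mulSn addnC -addSn leq_add2r.
have finj : injective f.
  move=> z z' /ffunP e; apply/ffunP => k; apply: val_inj => /=.
  by have /(congr1 val) := e k; rewrite /= !fE => /addnI.
have -> : (c ^ d)%N = #|[set: {ffun 'I_d -> 'I_c}]|.
  by rewrite cardsT card_ffun !card_ord.
rewrite -(card_imset _ finj); apply/subset_leq_card/fintype.subsetP.
move=> _ /imsetP[z _ ->]; rewrite inE; apply/same_cubeP => k.
by rewrite fE -/c divnMDl // (divn_small (ltn_ord (z k))) addn0.
Qed.

(** Summation over fibres: those that miss A contribute nothing on the left, so the local bound is
    needed only at points of A. *)
Lemma ler_card_fiberwise (R : realFieldType) (T I : finType) (f : T -> I)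
    (A B : {set T}) (p : R) :
  (forall y, y \in A -> #|[set x in B | f x == f y]|%:R
     <= p * #|[set x in A | f x == f y]|%:R) ->
  0 <= p -> #|B :&: A|%:R <= p * #|A|%:R.
Proof.
move=> BA p0.
have dec (C : {set T}) : #|C|%:R = \sum_i #|[set x in C | f x == i]|%:R :> R.
  rewrite -natr_sum -sum1_card (partition_big f predT) //=; congr _%:R.
  by apply: eq_bigr => i _; rewrite -sum1_card; apply: eq_bigl => x; rewrite !inE.
rewrite !dec mulr_sumr; apply: ler_sum => i _.
have [->|[y]] := set_0Vmem [set x in B :&: A | f x == i].
  by rewrite cards0 mulr_ge0.
rewrite !inE => /andP[/andP[_ yA] /eqP <-]; apply: le_trans (BA y yA).
rewrite ler_nat; apply/subset_leq_card/fintype.subsetP => x.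
by rewrite !inE => /andP[/andP[-> _] ->].
Qed.

Lemma floor_div_nat (R : realType) (n c : nat) : (0 < c)%N ->
  Num.floor (n%:R / c%:R : R) = (n %/ c)%N :> int.
Proof.
move=> c0; have c0' : 0 < c%:R :> R by rewrite ltr0n.
apply: floor_def; rewrite intrD -pmulrn ler_pdivlMr // ltr_pdivrMr //.
by rewrite natr1 -!natrM ler_nat ltr_nat leq_divM ltn_ceil.
Qed.

(** * Avoidance for finitely many indices *)

Lemma finite_avoidance (R : realType) (d h : nat) (delta : R) (t : nat -> R)
    (S : nat -> 'M[R]_d) (N : nat) :
  (0 < d)%N -> (0 < h)%N -> 0 < delta <= 1 / 2 -> d%:R * delta <= 1 ->
  (forall j, (1 <= j)%N -> 2 <= t j) ->
  (forall j, (1 <= j)%N -> t j <= t j.+1) ->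
  (forall j, (1 <= j)%N -> 2 * t j <= d%:R * delta * t (j + h)%N) ->
  (forall j, (1 <= j)%N -> orthogonal_mx (S j)) ->
  (20 * d%:R * delta) ^+ d * h%:R <= 1 / 4 ->
  exists2 alpha : 'cV[R]_d, (forall k, 0 <= alpha k 0 <= 1) &
    forall j, (1 <= j <= N)%N ->
      ~ near_lattice R d delta (t j *: S j *m alpha).
Proof.
move=> d0 h0 dl ddl t2 tmono th oS ph; have /andP[dl0 dl2] := dl.
set D := Num.sqrt (d%:R : R).
have D0 : 0 < D by rewrite sqrtr_gt0 ltr0n.
have DD : D * D = d%:R by rewrite -expr2 sqr_sqrtr // ler0n.
have D1 : 1 <= D by rewrite -sqrtr1 ler_wsqrtr // ler1n.
have tle i j : (1 <= i <= j)%N -> t i <= t j.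
  move=> /andP[i1]; elim: j => [|j IH]; first by rewrite leqn0 => /eqP ->.
  rewrite leq_eqVlt => /orP[/eqP->//|ij].
  by apply: le_trans (IH ij) (tmono _ (leq_trans i1 ij)).
have /choice[w hw] j : exists l : nat, (1 <= j)%N ->
    1 <= 2 ^+ l * (D * delta / t j) < 2.
  have [j1|] := boolP (1 <= j)%N; last by exists 0%N.
  have tj := t2 j j1; have tj0 : 0 < t j by lra.
  have [||l hl] := dyadic_scale R (D * delta / t j); last by exists l.
    by rewrite divr_gt0 // mulr_gt0.
  by rewrite ler_pdivrMr //; nra.
(* Level 0 is the whole unit cube; it serves the steps j + 1 <= h, where the truncated difference
   [j.+1 - h] is 0. *)
pose lev j := if j is 0%N then 0%N else w j.
have lev_mono i j : (i <= j)%N -> (lev i <= lev j)%N.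
  case: i => // i; case: j => // j ij; rewrite /lev.
  have /andP[_ wi] := hw i.+1 isT; have /andP[wj _] := hw j.+1 isT.
  have ti := t2 i.+1 isT; have tij := tle i.+1 j.+1 ij.
  have ti0 : 0 < t i.+1 by lra.
  have tj0 : 0 < t j.+1 by lra.
  rewrite -ltnS -(ltr_eXn2l (_ : 1 < 2 :> R)) ?ltr1n // exprS.
  move: wi wj; rewrite !mulrA ltr_pdivrMr // ler_pdivlMr //.
  set u := 2 ^+ _; set v := 2 ^+ _ => wi wj.
  have : u * D * delta < 2 * v * (D * delta) by nra.
  by rewrite -mulrA ltr_pM2r // mulr_gt0.
set L := lev N.
pose B j := bad_cubes R d L (lev j) delta (t j *: S j).
pose A := fix A j :=
  if j is i.+1 then A i :\: B j else [set: {ffun 'I_d -> 'I_(2 ^ L)}].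
have Asub i j : (i <= j)%N -> A j \subset A i.
  elim: j => [|j IH]; first by rewrite leqn0 => /eqP ->.
  rewrite leq_eqVlt => /orP[/eqP->//|ij].
  exact: fintype.subset_trans (subsetDl _ _) (IH ij).
have same_coarse i j x y : (i <= j <= N)%N ->
    same_cube d L (lev j) x y -> same_cube d L (lev i) x y.
  move=> /andP[ij jN] /same_cubeP s; apply/same_cubeP => k.
  by rewrite !(divn_exp_sub L (lev j) (lev i)) ?s // !lev_mono.
have Binv j x y : same_cube d L (lev j) x y -> (x \in B j) = (y \in B j).
  move=> /same_cubeP s; rewrite !inE; apply: asbool_equiv_eq.
  by split=> -[al c n]; exists al => // k; rewrite (c k) s.
(* [A j] is a union of cubes of level [lev j], so a cube meeting [A i] lies in it entirely and
   supplies the full count of cells. *)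
have Ainv j x y : (j <= N)%N -> same_cube d L (lev j) x y ->
    (x \in A j) = (y \in A j).
  elim: j => [|j IH] jN s; first by rewrite !inE.
  rewrite /= !finset.in_setD (Binv _ _ _ s) (IH (ltnW jN)) //.
  by apply: same_coarse s; rewrite leqnSn.
set p := _ ^+ d in ph.
have p0 : 0 <= p by rewrite exprn_ge0 // mulr_ge0 ?mulr_ge0 // ltW.
have step j : (j < N)%N ->
    #|A j|%:R - p * #|A (j.+1 - h)%N|%:R <= #|A j.+1|%:R.
  move=> jN; set i := (j.+1 - h)%N.
  have ij : (i <= j)%N by rewrite /i; lia.
  have bad : #|B j.+1 :&: A i|%:R <= p * #|A i|%:R.
    (* Each cell is labelled by its cube, taken as a set, so the fibres are the cubes of level
       [lev i]. *)
    apply: (ler_card_fiberwise _ _ _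
      (fun x => [set y | same_cube d L (lev i) x y])) => // y yA.
    have fE (C : {set {ffun 'I_d -> 'I_(2 ^ L)}}) :
        [set x in C | [set z | same_cube d L (lev i) x z]
                        == [set z | same_cube d L (lev i) y z]] =
        [set x in C | same_cube d L (lev i) x y].
      apply/setP => x; rewrite !inE; congr (_ && _); apply/eqP/idP.
        by move/setP/(_ y); rewrite !inE => ->; apply/same_cubeP.
      move=> /same_cubeP s; apply/setP => z; rewrite !inE.
      by apply/same_cubeP/same_cubeP => s' k; rewrite -s' s.
    rewrite !fE.
    apply: le_trans (_ : p * (2 ^+ (L - lev i)) ^+ d <= _); last first.
      rewrite ler_wpM2l // -!natrX ler_nat.
      apply: leq_trans (card_same_cube d L (lev i) y _) _.
        by rewrite lev_mono // (leq_trans ij) // ltnW.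
      apply/subset_leq_card/fintype.subsetP => x; rewrite !inE => s.
      by rewrite s (Ainv _ _ _ _ s) ?yA // (leq_trans ij) // ltnW.
    apply: ler_card_bad_cubes => //.
    - by rewrite !lev_mono // leqW.
    - by apply: lt_le_trans (t2 j.+1 isT).
    - exact: oS.
    (* With i = j + 1 - h > 0, the choice of level gives 2^(lev i) D delta < 2 t_i, and growth over
       h steps gives 2 t_i <= D^2 delta t_(j+1); cancelling D delta yields T >= 1. *)
    - rewrite -/D ler_pdivlMr ?exprn_gt0 // mul1r.
      have tj := t2 j.+1 isT.
      case: (posnP i) => [->|i0]; first by rewrite expr0; nra.
      have := hw i i0; have := th i i0.
      have -> : (i + h)%N = j.+1 by rewrite /i in i0 *; lia.
      have ti := t2 i i0; have ti0 : 0 < t i by lra.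
      rewrite /lev -(prednK i0) /= (prednK i0).
      rewrite -DD !mulrA ltr_pdivrMr // => th' /andP[_ w2].
      set u := 2 ^+ _ in w2 *.
      have : D * delta * u <= D * delta * (t j.+1 * D) by nra.
      by rewrite ler_pM2l // mulr_gt0.
    - by have /andP[] := hw j.+1 isT.
  rewrite /= -(cardsID (B j.+1) (A j)) natrD.
  suff : #|A j :&: B j.+1|%:R <= p * #|A i|%:R by lra.
  apply: le_trans bad; rewrite ler_nat; apply: subset_leq_card.
  by rewrite finset.setIC; apply: finset.setIS; apply: Asub.
have : 0 < #|A N|%:R :> R.
  apply: (delayed_recursion_gt0 _ (fun j => #|A j|%:R) p h N) => //.
  rewrite ltr0n card_gt0; apply/set0Pn.
  have e0 : (0 < 2 ^ L)%N by rewrite expn_gt0.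
  by exists [ffun=> Ordinal e0]; rewrite inE.
rewrite ltr0n card_gt0 => /set0Pn[x xA].
(* The lower corner of a surviving cell lies in all cubes containing that cell, so were it near the
   lattice at j, the cell would belong to [B j]. *)
pose alpha : 'cV[R]_d := \col_k ((x k)%:R / (2 ^ L)%:R).
exists alpha => [k|j /andP[j1 jN] nl].
  rewrite mxE divr_ge0 //= ler_pdivrMr ?ltr0n ?expn_gt0 // mul1r.
  by rewrite ler_nat ltnW.
have /negP[] : x \notin B j.
  case: j j1 jN nl => // j _ /Asub/fintype.subsetP/(_ _ xA).
  by rewrite inE => /andP[].
rewrite inE; apply/asboolP; exists alpha => // k.
have lL : (lev j <= L)%N by exact: lev_mono.
rewrite mxE -(floor_div_nat R) ?expn_gt0 //; congr Num.floor.
rewrite -[in X in _ / X](subnK lL) expnD natrM !natrX.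
by field; rewrite !expf_neq0 ?pnatr_eq0.
Qed.

(** * Passage to all indices by compactness *)

(** The same n works nearby: finitely many strict inequalities between continuous functions. Row
    vectors match the form of [rV_compact]. *)
Lemma near_lattice_open (R : realType) (d : nat) (delta : R) (G : 'M[R]_d)
    (v : 'rV[R]_d) :
  near_lattice R d delta (G *m v^T) ->
  \forall u \near v, near_lattice R d delta (G *m u^T).
Proof.
move=> [n hn].
have cont k : continuous (fun u : 'rV[R]_d => \sum_j G k j * u 0 j).
  apply: (@continuous_big _ _ +%R) => [w|j _]; first exact: add_continuous.
  move=> u.
  apply: (@continuous_comp _ _ _ (fun u : 'rV[R]_d => u 0 j) ( *%R (G k j))).
    exact: coord_continuous.
  exact: mulrl_continuous.
have : \forall u \near v, forall k, `|(G *m u^T) k 0 - (n k)%:~R| < delta.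
  apply: (@filter_forall _ _ (fun k u => `|(G *m u^T) k 0 - (n k)%:~R| < delta)
    _ (nbhs_filter v)) => k.
  have e0 : 0 < delta - `|(G *m v^T) k 0 - (n k)%:~R| by rewrite subr_gt0.
  have /cvgrPdist_lt/(_ _ e0) := cont k v; apply: filterS => u.
  have mE (w : 'rV[R]_d) : \sum_j G k j * w 0 j = (G *m w^T) k 0.
    by rewrite mxE; apply: eq_bigr => j _; rewrite mxE.
  rewrite !mE ltrBrDr -[X in _ -> `|X| < _](subrKA ((G *m v^T) k 0)) distrC.
  exact/le_lt_trans/ler_normD.
by apply: filterS => u hu; exists n.
Qed.

(** A cluster point of the finite solutions works: if it failed at j, openness would make some
    solution for N >= j fail there too. *)
Lemma compact_avoidance (R : realType) (d : nat) (delta : R)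
    (G : nat -> 'M[R]_d) :
  (forall N, exists2 alpha : 'cV[R]_d, (forall k, 0 <= alpha k 0 <= 1) &
    forall j, (1 <= j <= N)%N -> ~ near_lattice R d delta (G j *m alpha)) ->
  exists alpha : 'cV[R]_d,
    forall j, (1 <= j)%N -> ~ near_lattice R d delta (G j *m alpha).
Proof.
move=> fin.
have /choice[a ha] N : exists alpha : 'cV[R]_d,
    (forall k, 0 <= alpha k 0 <= 1) /\
    forall j, (1 <= j <= N)%N -> ~ near_lattice R d delta (G j *m alpha).
  by have [al h1 h2] := fin N; exists al.
pose F := ((fun N => (a N)^T) @ \oo)%classic.
have PF : ProperFilter F by exact: fmap_proper_filter.
have Fseg : F [set v : 'rV[R]_d | forall i, `[0, 1]%classic (v 0 i)]%classic.
  by exists 0%N => // N _ i /=; rewrite mxE in_itv /=; exact: (ha N).1.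
have [v [_ clv]] := rV_compact (fun=> @segment_compact R 0 1) PF Fseg.
exists v^T => j j1 nl.
have Ftail : F [set u | exists2 N, (j <= N)%N & u = (a N)^T]%classic.
  by exists j => // N jN; exists N.
have [_ [[N jN ->]]] := clv _ _ Ftail (near_lattice_open _ _ _ _ _ nl).
by rewrite /= trmxK; apply: (ha N).2; rewrite j1.
Qed.

(** * Growth of a lacunary sequence *)

(** From ln(1 + x) <= x at x = -1/2 one gets ln 8 = -3 ln(1/2) >= 3/2. *)
Lemma one_le_ln (R : realType) (M : R) : 8 <= M -> 1 <= ln M.
Proof.
move=> M8; apply: le_trans (_ : ln 8 <= _); last by rewrite ler_ln ?posrE; lra.
have -> : 8 = 2^-1 ^- 3 :> R by field.
rewrite lnV ?posrE ?exprn_gt0 ?invr_gt0 // lnXn ?invr_gt0 //.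
have h : -1 < - (1 / 2) :> R by lra.
have := le_ln1Dx h; have -> : 1 - 1 / 2 = 2^-1 :> R by field.
by rewrite -mulr_natl; lra.
Qed.

(** With u = 1/(2M), exp(-u) >= 1 - u gives (1 - u) exp(u) <= 1 <= (1 - u)(1 + 2u). *)
Lemma expR_half_inv_le (R : realType) (M : R) : 8 <= M ->
  expR (1 / (2 * M)) <= 1 + 1 / M.
Proof.
move=> M8; have M0 : 0 < M by lra.
have := expR_ge1Dx (- (1 / (2 * M))); rewrite expRN.
have e0 := expR_gt0 (1 / (2 * M)); set e := expR _ in e0 *.
rewrite -(ler_pM2r e0) mulVf ?gt_eqF // => h.
have -> : 1 / M = 2 * (1 / (2 * M)) by field; rewrite gt_eqF.
have : 0 < 1 / (2 * M) <= 1 / 4.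
  by rewrite divr_gt0 ?mulr_gt0 //= ler_pdivrMr; lra.
set u := 1 / (2 * M) in h * => /andP[u0 u4].
have : (1 - u) * e <= (1 - u) * (1 + 2 * u) by nra.
by rewrite ler_pM2l //; lra.
Qed.

(** The growth factor is at least exp(h/(2M)) >= exp(7 ln M). The exponent 7 leaves M^5 for
    numerical constants and M^2 for M ln M. *)
Lemma lacunary_growth (R : realType) (M : R) (t : nat -> R) (h j : nat) :
  8 <= M -> 14 * (M * ln M) <= h%:R ->
  (forall j, (1 <= j)%N -> 0 < t j) ->
  (forall j, (1 <= j)%N -> 1 + 1 / M <= t j.+1 / t j) ->
  (1 <= j)%N -> M ^+ 7 * t j <= t (j + h)%N.
Proof.
move=> M8 hh t0 lac j1; have M0 : 0 < M by lra.
have : forall i, (1 + 1 / M) ^+ i * t j <= t (j + i)%N.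
  elim=> [|i IH]; first by rewrite addn0 expr0 mul1r.
  have ji : (1 <= j + i)%N by rewrite (leq_trans j1) ?leq_addr.
  rewrite addnS; apply: le_trans (_ : (1 + 1 / M) * t (j + i)%N <= _).
    by rewrite exprS -mulrA ler_wpM2l // addr_ge0 // divr_ge0 // ltW.
  by rewrite -ler_pdivlMr ?t0 // lac.
move=> /(_ h); apply: le_trans; rewrite ler_wpM2r ?(ltW (t0 j j1)) //.
apply: le_trans (_ : expR (1 / (2 * M)) ^+ h <= _); last first.
  rewrite lerXn2r ?nnegrE ?expR_ge0 ?expR_half_inv_le //.
  by rewrite addr_ge0 // divr_ge0 // ltW.
rewrite -{1}(lnK (_ : M \is Num.pos)) ?posrE // -!expRM_natr ler_expR.
rewrite mulrAC mul1r ler_pdivlMr; lra.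
Qed.

(** * Choice of the constants *)

Theorem theorem2 (R : realType) (d : nat) (M : R) (t : nat -> R)
    (S G : nat -> 'M[R]_d)
    (d_gt0 : (0 < d)%N)
    (M_ge8 : 8 <= M)
    (t_gt0 : forall j : nat, (1 <= j)%N -> 0 < t j)
    (t1_ge2 : 2 <= t 1%N)
    (t_lacunary : forall j : nat, (1 <= j)%N -> 1 + 1 / M <= t j.+1 / t j)
    (S_orthogonal : forall j : nat, (1 <= j)%N -> orthogonal_mx (S j))
    (G_def : forall j : nat, (1 <= j)%N -> G j = t j *: S j) :
  exists alpha : 'cV[R]_d, forall j : nat, (1 <= j)%N ->
    1 / (2 ^+ 13 * d%:R * (M * ln M) `^ (1 / d%:R))
      <= dist_lattice (G j *m alpha).
Proof.
have M0 : 0 < M by lra.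
have d0 : 0 < d%:R :> R by rewrite ltr0n.
have d1 : 1 <= d%:R :> R by rewrite ler1n.
set q := M * ln M; set W := q `^ _; set delta := 1 / _.
have lnM1 := one_le_ln R M M_ge8.
have q8 : 8 <= q by rewrite /q; nra.
have W1 : 1 <= W.
  by rewrite -(powRr0 q) ler_powR ?divr_ge0 ?(ltW d0) //; lra.
have Wq : W <= q.
  by apply: ler1_powR; [lra|rewrite ler_pdivrMr // mul1r].
(* The exponent 1/d makes the spoiled proportion p inversely proportional to q, matching a delay h
   proportional to q. *)
have Wd : W ^+ d = q.
  rewrite -powR_mulrn ?powR_ge0 // -powRrM mul1r mulVf ?gt_eqF // powRr1 //.
  by lra.
have W0 : 0 < W by lra.
have qM : q <= M ^+ 2.
  by rewrite expr2 /q ler_wpM2l ?(ltW M0) // ltW // ln_sublinear.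
have delta_d : d%:R * delta = 1 / (2 ^+ 13 * W).
  by rewrite /delta; field; rewrite !gt_eqF.
have delta0 : 0 < delta by rewrite divr_gt0 // !mulr_gt0 // exprn_gt0.
have dd : d%:R * delta <= 1 / 2.
  rewrite delta_d ler_pdivrMr ?mulr_gt0 ?exprn_gt0 //.
  have : 2 <= 2 ^+ 13 :> R by rewrite -natrX ler_nat.
  by set c := 2 ^+ 13; nra.
pose h := (Num.truncn (14 * q)).+1.
have h14 : 14 * q <= h%:R by apply/ltW/truncnS_gt.
have h15 : h%:R <= 15 * q.
  have : (Num.truncn (14 * q))%:R <= 14 * q by rewrite truncn_le; lra.
  by rewrite /h -natr1; lra.
have tmono j : (1 <= j)%N -> t j <= t j.+1.
  move=> j1; have := t_lacunary j j1; rewrite ler_pdivlMr ?t_gt0 //.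
  apply: le_trans; rewrite ler_peMl ?(ltW (t_gt0 j j1)) // lerDl.
  by rewrite divr_ge0 // ltW.
have t_ge2 j : (1 <= j)%N -> 2 <= t j.
  case: j => // j _; elim: j => // j IH.
  exact: le_trans IH (tmono j.+1 isT).
have growth j : (1 <= j)%N -> 2 * t j <= d%:R * delta * t (j + h)%N.
  move=> j1; rewrite delta_d mulrAC mul1r ler_pdivlMr ?mulr_gt0 ?exprn_gt0 //.
  apply: le_trans (lacunary_growth _ _ _ h _ M_ge8 h14 t_gt0 t_lacunary j1).
  rewrite mulrAC ler_wpM2r ?(ltW (t_gt0 j j1)) // mulrA -exprS.
  (* The required factor is 2^14 W: M^5 >= 8^5 = 2^15 covers the constant, and M^2 >= q >= W the
     rest. *)
  have M5 : 2 ^+ 14 <= M ^+ 5.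
    apply: le_trans (_ : 8 ^+ 5 <= _); first by rewrite -!natrX ler_nat.
    by rewrite lerXn2r // nnegrE; lra.
  have -> : M ^+ 7 = M ^+ 5 * M ^+ 2 by rewrite -exprD.
  by apply: ler_pM; rewrite ?exprn_ge0 ?(ltW W0) ?(le_trans Wq).
have ph : (20 * d%:R * delta) ^+ d * h%:R <= 1 / 4.
  (* Now p h <= 15 (20/2^13)^d <= 300/2^13 < 1/4. *)
  have -> : 20 * d%:R * delta = 20 / 2 ^+ 13 / W.
    by rewrite -mulrA delta_d; field; rewrite gt_eqF.
  have q0 : 0 < q by lra.
  rewrite expr_div_n Wd mulrAC ler_pdivrMr //.
  have : (20 / 2 ^+ 13) ^+ d <= 20 / 2 ^+ 13 :> R.
    by rewrite -[leRHS]expr1 ler_wiXn2l //; lra.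
  have : 0 <= (20 / 2 ^+ 13 : R) ^+ d by rewrite exprn_ge0 //; lra.
  by set c := _ ^+ d => c0 c1; nra.
have [alpha ha] : exists alpha : 'cV[R]_d,
    forall j, (1 <= j)%N -> ~ near_lattice R d delta (t j *: S j *m alpha).
  apply: compact_avoidance => N.
  apply: (finite_avoidance R d h) => //; last by lra.
  by rewrite delta0 /=; nra.
exists alpha => j j1; rewrite leNgt; apply/negP => close.
apply: (ha j j1); rewrite -G_def //.
have /choice[n hn] k : exists n : int,
    `|(G j *m alpha) k 0 - n%:~R| < delta.
  have [n [e _]] := dist_int_min ((G j *m alpha) k 0).
  exists n; rewrite -e; apply: le_lt_trans close.
  exact: (le_bigmax _ (fun k => dist_int ((G j *m alpha) k 0))).
by exists n.
Qed.
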